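(* Let $\tau$ be the Golomb topology on $\mathbb{N}=\{1,2,3,\dots\}$ and let $C(\mathbb{N}_\tau)\subset\mathbb{N}^{\mathbb{N}}$ be the set of all continuous maps from $(\mathbb{N},\tau)$ to itself. Then $C(\mathbb{N}_\tau)$ contains a subset of cardinality continuum which is closed in $\mathbb{N}^{\mathbb{N}}$.
   Context: $\mathbb{N}$ is the set of positive integers and $\mathbb{N}_0=\{0\}\cup\mathbb{N}$. The Golomb topology $\tau$ on $\mathbb{N}$ is the topology generated by the base consisting of all arithmetic progressions $a+b\mathbb{N}_0=\{a+bn:n\in\mathbb{N}_0\}$ with $a,b\in\mathbb{N}$ coprime. The set $\mathbb{N}^{\mathbb{N}}$ of all self-maps of $\mathbb{N}$ is endowed with the (Polish) topology of the Tychonoff product of countably many copies of the discrete space $\mathbb{N}$. *)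

(* Defs.v *)
From HB Require Import structures.
From mathcomp Require Import all_boot all_order all_algebra.
From mathcomp Require Import all_classical all_reals all_analysis.

Set Implicit Arguments.
Unset Strict Implicit.
Unset Printing Implicit Defensive.

Local Open Scope classical_set_scope.

Definition posnat : Type := {n : nat | (0 < n)%N}.

HB.instance Definition _ := Choice.on posnat.
HB.instance Definition _ := isPointed.Build posnat (exist _ 1%N isT).

(* [step] is multiplied by an arbitrary [n : nat], so the progression contains
   its first term. *)
Definition progression (start step : posnat) : set posnat :=
  [set x | exists n : nat, val x = (val start + val step * n)%N].

(* An alias, so that [posnat] itself carries no topology. *)
Definition golomb : Type := posnat.

HB.instance Definition _ := Choice.on golomb.

Definition golomb_index : set (posnat * posnat) :=
  [set ab | coprime (val ab.1) (val ab.2)].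

Definition golomb_base (ab : posnat * posnat) : set golomb :=
  progression ab.1 ab.2.

Lemma golomb_base_cover : \bigcup_(ab in golomb_index) golomb_base ab = setT.
Proof.
apply/seteqP; split=> // x _; exists (x, exist _ 1%N isT).
  exact: coprimen1.
by exists 0%N; rewrite muln0 addn0.
Qed.

Lemma golomb_base_join (i j : posnat * posnat) (x : golomb) :
  golomb_index i -> golomb_index j -> golomb_base i x -> golomb_base j x ->
  exists k, [/\ golomb_index k, golomb_base k x &
    golomb_base k `<=` golomb_base i `&` golomb_base j].
Proof.
move: i j => [a b] [c d] /= cab ccd [m /= xm] [n /= xn].
have bd_gt0 : (0 < val b * val d)%N by rewrite muln_gt0 (valP b) (valP d).
exists (x, exist _ (val b * val d)%N bd_gt0); split.
- rewrite /golomb_index /= coprimeMr; apply/andP; split.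
    by rewrite xm /coprime gcdnC addnC mulnC gcdnMDl gcdnC.
  by rewrite xn /coprime gcdnC addnC mulnC gcdnMDl gcdnC.
- by exists 0%N; rewrite muln0 addn0.
- move=> y [k /= yk]; split.
    by exists (m + val d * k)%N; rewrite /= yk xm mulnDr mulnA addnA.
  by exists (n + val b * k)%N; rewrite /= yk xn mulnDr mulnA addnA (mulnC (val b)).
Qed.

HB.instance Definition _ :=
  isBaseTopological.Build golomb golomb_base_cover golomb_base_join.

Lemma golomb_openP (A : set golomb) :
  open A <-> forall x, A x -> exists a b : posnat,
    [/\ coprime (val a) (val b), progression a b x & progression a b `<=` A].
Proof.
split=> [[D' D'D <-] x [[a b] D'ab abx]|oA].
  exists a, b; split=> //; first exact: D'D D'ab.
  by move=> y aby; exists (a, b).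
exists [set ab | golomb_index ab /\ golomb_base ab `<=` A].
  by move=> ab [].
apply/seteqP; split=> [x [ab [_ abA] /abA]//|x /oA [a [b [cab abx abA]]]].
by exists (a, b).
Qed.

Definition golomb_maps : set {ptws posnat -> discrete_topology posnat} :=
  [set f | continuous (f : golomb -> golomb)].

(* Main.v *)
(** For a sequence [e] of bits let [f_e x = x + \sum_n e_n x (x-1) ... (x-n)].
Only the terms with [n < x] are nonzero, so [f_e] is a well-defined monotone
map which locally behaves like a polynomial with integer coefficients:
[f_e (x + b k) = f_e x] modulo [b]. Moreover [x] divides [f_e x], so every [b]
coprime to [f_e x] is coprime to [x]; hence [f_e] is continuous for the Golomb
topology. Since [f_e (n+1)] reveals [e_n] once [e_0, ..., e_(n-1)] are known and
depends on finitely many bits only, [e |-> f_e] is a continuous injection of the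
Cantor space, whose image is compact and has the cardinality of the continuum. *)

Require Import Defs.
From mathcomp Require Import all_boot all_order all_algebra.
From mathcomp Require Import all_classical all_reals all_analysis.
From mathcomp Require Import lra.

Local Open Scope classical_set_scope.
Local Open Scope card_scope.

(** * Arithmetic of falling factorials and of the series *)

Lemma leq_ffact2r (m n k : nat) : (m <= n)%N -> (m ^_ k <= n ^_ k)%N.
Proof.
by move=> mn; rewrite !ffact_prod leq_prod// => i _; exact: leq_sub2r.
Qed.

Lemma modn_ffactD (b k x n : nat) : ((x + b * k) ^_ n = x ^_ n %[mod b])%N.
Proof.
elim: n => [|n IHn]; first by rewrite !ffactn0.
rewrite !ffactnSr -modnMml IHn modnMml.
(* For [x < n] the truncated difference [x - n] loses the congruence, but the factor [x ^_ n] is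
   then zero. *)
have [nx|xn] := leqP n x; last by rewrite (ffact_small xn).
by rewrite -addnBAC// mulnDr mulnCA addnC mulnC modnMDl.
Qed.

Definition ffact_series (e : nat -> bool) (x : nat) : nat :=
  (x + \sum_(n < x) e n * x ^_ n.+1)%N.

(** The added terms vanish; this lets values at different points be compared term by term. *)
Lemma ffact_series_widen (e : nat -> bool) (N x : nat) : (x <= N)%N ->
  ffact_series e x = (x + \sum_(n < N) e n * x ^_ n.+1)%N.
Proof.
move=> xN; rewrite /ffact_series -(subnKC xN) big_split_ord/=.
rewrite [X in (_ + (_ + X))%N]big1 ?addn0// => i _.
by rewrite ffact_small ?muln0// ltnS leq_addr.
Qed.

Lemma ffact_series_gt0 (e : nat -> bool) (x : nat) :
  (0 < x)%N -> (0 < ffact_series e x)%N.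
Proof. by move=> x0; rewrite /ffact_series addn_gt0 x0. Qed.

Lemma leq_ffact_series (e : nat -> bool) (x y : nat) :
  (x <= y)%N -> (ffact_series e x <= ffact_series e y)%N.
Proof.
move=> xy; rewrite (ffact_series_widen e _ _ xy) leq_add// leq_sum// => i _.
by rewrite leq_mul// leq_ffact2r.
Qed.

Lemma dvdn_ffact_series (e : nat -> bool) (x : nat) :
  (x %| ffact_series e x)%N.
Proof.
rewrite dvdn_add// dvdn_sum// => i _.
by rewrite ffactnS dvdn_mull// dvdn_mulr.
Qed.

Lemma modn_ffact_series (e : nat -> bool) (b k x : nat) :
  (ffact_series e (x + b * k) = ffact_series e x %[mod b])%N.
Proof.
rewrite (ffact_series_widen e _ _ (leq_addr (b * k)%N x)) {1}/ffact_series.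
have modD (u u' v v' : nat) : (u = u' %[mod b])%N -> (v = v' %[mod b])%N ->
    (u + v = u' + v' %[mod b])%N.
  by move=> uu' vv'; rewrite -modnDm uu' vv' modnDm.
apply: (modD); first by rewrite addnC mulnC modnMDl.
apply: (big_ind2 (fun u v => u = v %[mod b])%N) => [//|u u' v v'|i _].
  exact: modD.
by rewrite -modnMmr modn_ffactD modnMmr.
Qed.

Lemma eq_ffact_series (e d : nat -> bool) (x : nat) :
  (forall i, (i < x)%N -> e i = d i) -> ffact_series e x = ffact_series d x.
Proof. by move=> ed; congr addn; apply: eq_bigr => i _; rewrite ed. Qed.

Lemma ffact_series_inj (e d : nat -> bool) :
  (forall x, (0 < x)%N -> ffact_series e x = ffact_series d x) -> e = d.
Proof.
move=> ed; apply/funext => n; elim/ltn_ind: n => n IHn.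
have := ed n.+1 isT; rewrite /ffact_series !big_ord_recr/=.
rewrite (eq_bigr (fun i : 'I_n => d i * n.+1 ^_ i.+1)%N); last first.
  by move=> i _; rewrite IHn.
(* Only the last terms remain, namely [e n] and [d n] times the positive number [n.+1 ^_ n.+1]. *)
move=> /addnI/addnI/eqP; rewrite eqn_pmul2r ?ffact_gt0//.
by case: (e n) (d n) => -[].
Qed.

(** * Golomb continuity of the maps and continuity in the bits *)

Definition ffact_map (e : cantor_space) :
    {ptws posnat -> discrete_topology posnat} :=
  fun x => exist _ (ffact_series e (val x)) (ffact_series_gt0 e _ (valP x)).

Lemma ffact_map_inj : injective ffact_map.
Proof.
move=> e d /(congr1 (fun f => fun x => val (f x))) ed.
apply: ffact_series_inj => x x0.
exact: (congr1 (@^~ (exist _ x x0)) ed).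
Qed.

Lemma ffact_map_golomb (e : cantor_space) : golomb_maps (ffact_map e).
Proof.
apply/continuousP => A /golomb_openP oA; apply/golomb_openP => x /oA.
move=> [a [b [cab [m fx] abA]]].
exists x, b; split.
- apply: (coprime_dvdl (dvdn_ffact_series e (val x))).
  by move: fx => /= ->; rewrite /coprime gcdnC addnC mulnC gcdnMDl gcdnC.
- by exists 0%N; rewrite muln0 addn0.
move=> y [k yE]; apply: abA.
(* Progressions are one-sided, so the congruence modulo [b] must be supplemented by monotonicity. *)
have lexy : (ffact_series e (val x) <= ffact_series e (val y))%N.
  by apply: leq_ffact_series; rewrite yE leq_addr.
have /eqP := modn_ffact_series e (val b) k (val x).
rewrite -yE (eqn_mod_dvd _ lexy) => /dvdnP[q qE].
exists (m + q)%N => /=; move: fx => /= fx.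
by rewrite -(subnKC lexy) qE fx mulnDr addnA (mulnC q).
Qed.

Lemma cantor_cylinder_nbhs (e : cantor_space) (N : nat) :
  \forall d \near e, forall i, (i < N)%N -> e i = d i.
Proof.
elim: N => [|N IHN]; first by near=> d.
have eN : \forall d \near e, e N = d N.
  exists (proj N @^-1` [set e N]); split => //.
  suff : @open cantor_space (proj N @^-1` [set e N]) by [].
  apply: open_comp; last exact: discrete_open.
  by move=> d _; exact: proj_continuous.
near=> d => i; rewrite ltnS leq_eqVlt => /predU1P[->|]; first by near: d.
by move: i; near: d.
Unshelve. all: by end_near. Qed.

Lemma ffact_map_continuous : continuous ffact_map.
Proof.
(* It suffices to treat each coordinate [x], and the value there depends only on the first [x]
   bits. *)
move=> e; apply/cvg_sup => x U [V] [[W oW <-]] Wex WU.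
have := cantor_cylinder_nbhs e (val x); apply: filterS => d ed.
apply: WU => /=; suff <- : ffact_map e x = ffact_map d x by [].
exact/val_inj/eq_ffact_series.
Qed.

(** * The Cantor space has the cardinality of the real line *)

Section continuum.
Context {R : realType}.
Local Open Scope ring_scope.
Import Order.TTheory GRing.Theory Num.Theory.

(** A real is encoded by its Dedekind cut, the rationals being enumerated by [pickle]; a rational
    between two reals separates their cuts. *)
Lemma card_real_le_cantor : [set: R] #<= [set: cantor_space].
Proof.
apply/pcard_injP.
exists (fun r n => if unpickle n is Some q then ratr q < r else false).
suff inj (r s : R) : r < s -> ~ ((fun n => if unpickle n is Some q
    then ratr q < r else false) = (fun n => if unpickle n is Some q
    then ratr q < s else false)).
  by move=> r s _ _ rs; have [/inj|/inj/(_ (esym rs))|] := ltgtP r s.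
move=> /rat_in_itvoo[q]; rewrite in_itv/= => /andP[rq qs].
by move=> /(congr1 (@^~ (pickle q))); rewrite pickleK qs ltNge (ltW rq).
Qed.

(** Base 3 with digits 0 and 1 avoids the double expansions of base 2, so the limit determines the
    bits. *)
Definition ternary_sum (e : cantor_space) (n : nat) : R :=
  \sum_(i < n) (e i)%:R / 3%:R ^+ i.

Lemma ternary_sumS (e : cantor_space) (n : nat) :
  ternary_sum e n.+1 = ternary_sum e n + (e n)%:R / 3%:R ^+ n.
Proof. by rewrite /ternary_sum big_ord_recr. Qed.

Lemma nondecreasing_ternary_sum (e : cantor_space) :
  nondecreasing_seq (ternary_sum e).
Proof.
apply/nondecreasing_seqP => n; rewrite ternary_sumS lerDl.
by rewrite divr_ge0// exprn_ge0.
Qed.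

(* [2^-1 * 3^-n * 3] is the sum of the geometric series [3^-i] over [i >= n]. *)
Lemma ternary_sum_le (e : cantor_space) (n m : nat) :
  ternary_sum e m <= ternary_sum e n + 3%:R / 2%:R / 3%:R ^+ n.
Proof.
(* The upper bounds [u] decrease while the partial sums increase, so both sides can be compared at
   [maxn n m]. *)
set u := fun n => ternary_sum e n + 3%:R / 2%:R / 3%:R ^+ n.
have u_noninc : nonincreasing_seq u.
  apply/nonincreasing_seqP => k; rewrite /u ternary_sumS -addrA lerD2l.
  have pos3 : 0 < (3%:R ^+ k : R)^-1 by rewrite invr_gt0 exprn_gt0.
  have : (e k)%:R <= 1 :> R by case: (e k).
  rewrite exprS invfM; move: (3%:R ^+ k)^-1 pos3 => z z0 ek.
  nra.
apply: (@le_trans _ _ (u (maxn n m))); last exact/u_noninc/leq_maxl.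
apply: (@le_trans _ _ (ternary_sum e (maxn n m))).
  exact/nondecreasing_ternary_sum/leq_maxr.
by rewrite lerDl divr_ge0// ?exprn_ge0// divr_ge0.
Qed.

(** At index [n] the sum of [d] gains [3^-n], whereas all later terms of [e] add up to at most half
    of that. *)
Lemma sup_ternary_sum_lt (e d : cantor_space) (n : nat) :
  (forall i, (i < n)%N -> e i = d i) -> ~~ e n -> d n ->
  sup (range (ternary_sum e)) < sup (range (ternary_sum d)).
Proof.
move=> ed /negbTE en dn.
have sum_ed : ternary_sum e n = ternary_sum d n.
  by apply: eq_bigr => i _; rewrite ed.
have le_sup : ternary_sum d n.+1 <= sup (range (ternary_sum d)).
  apply: ub_le_sup; last by exists n.+1.
  exists (ternary_sum d 0 + 3%:R / 2%:R / 3%:R ^+ 0) => _ [m _ <-].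
  exact: ternary_sum_le.
have sup_le : sup (range (ternary_sum e)) <=
    ternary_sum e n.+1 + 3%:R / 2%:R / 3%:R ^+ n.+1.
  apply: ge_sup; first by exists (ternary_sum e 0); exists 0%N.
  by move=> _ [m _ <-]; exact: ternary_sum_le.
have pos3 : 0 < (3%:R ^+ n : R)^-1 by rewrite invr_gt0 exprn_gt0.
move: le_sup sup_le; rewrite !ternary_sumS en dn sum_ed exprS invfM.
move: (3%:R ^+ n)^-1 pos3 => z z0; rewrite mul1r mul0r addr0 => le_sup sup_le.
by apply: (le_lt_trans sup_le); apply: lt_le_trans le_sup; lra.
Qed.

Lemma card_cantor_le_real : [set: cantor_space] #<= [set: R].
Proof.
suff sup_inj : injective (fun e => sup (range (ternary_sum e))).
  have /card_esym/card_eqPle[+ _] := inj_card_eq (A := setT) (in2W sup_inj).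
  by move/card_le_trans; apply; exact: card_leT.
move=> e d sup_ed; apply/funext; apply: contrapT => /existsNP[k /eqP ed].
(* The first disagreement decides which supremum is smaller. *)
have [n edn nmin] := ex_minnP (ex_intro (fun n => e n != d n) k ed).
have eqn i : (i < n)%N -> e i = d i.
  by move=> ltin; apply: contraTeq ltin => /nmin; rewrite -leqNgt.
have [en|en] := boolP (e n).
  have dn : ~~ d n by move: edn; rewrite en; case: (d n).
  have := sup_ternary_sum_lt d e n (fun i lin => esym (eqn i lin)) dn en.
  by rewrite sup_ed ltxx.
have dn : d n by move: edn en; case: (e n) (d n) => -[].
by have := sup_ternary_sum_lt e d n eqn en dn; rewrite sup_ed ltxx.
Qed.

Lemma card_cantor : [set: cantor_space] #= [set: R].
Proof.
exact: (Cantor_Bernstein card_cantor_le_real card_real_le_cantor).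
Qed.

End continuum.

Theorem theorem4p8 (R : realType) :
  exists A : set {ptws posnat -> discrete_topology posnat},
    [/\ A `<=` golomb_maps, A #= [set: R] & closed A].
Proof.
exists (range ffact_map); split.
- by move=> _ [e _ <-]; exact: ffact_map_golomb.
- apply: card_eq_trans card_cantor.
  by apply: inj_card_eq => e d _ _; exact: ffact_map_inj.
- apply: compact_closed.
    by apply: hausdorff_product => x; exact: discrete_hausdorff.
  apply: continuous_compact; last exact: cantor_space_compact.
  by apply: continuous_subspaceT; exact: ffact_map_continuous.
Qed.
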